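(* Let $f:[0,\infty)\to[0,\infty)$ be $2$-radical convex and let $a,b\ge 0$. Then $$f(a)+f(b)+f\left(\sqrt{2ab}\right)\le f(a+b).$$
   Context: Let $p\ge 1$. A continuous function $f:[0,\infty)\to[0,\infty)$ with $f(0)=0$ is called $p$-radical convex if the function $x\mapsto f\left(x^{1/p}\right)$ is convex on $[0,\infty)$. In particular $f$ is $2$-radical convex if $x\mapsto f(\sqrt{x})$ is convex on $[0,\infty)$. *)

(* Defs.v *)
From mathcomp Require Import all_boot all_order all_algebra.
From mathcomp Require Import all_classical all_reals all_analysis.
Import Order.TTheory GRing.Theory Num.Theory.
Import numFieldNormedType.Exports.

Set Implicit Arguments.
Unset Strict Implicit.
Unset Printing Implicit Defensive.

Local Open Scope classical_set_scope.
Local Open Scope ring_scope.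

(* A function [0, +oo[ -> [0, +oo[ is represented by f : R -> R of which only
   the restriction to [0, +oo[ is constrained. The p-th root x^(1/p) is the real
   power x `^ p^-1, whose value at x = 0 is 0 since p^-1 != 0. *)
Definition radical_convex (R : realType) (p : R) (f : R -> R) : Prop :=
  [/\ 1 <= p,
      {within `[0, +oo[, continuous f},
      forall x : R, 0 <= x -> 0 <= f x,
      f 0 = 0 &
      convex_function (`[0, +oo[ : set R) (fun x : R => f (x `^ p^-1))].

(* Main.v *)
Require Import Defs.
From mathcomp Require Import all_boot all_order all_algebra.
From mathcomp Require Import all_classical all_reals all_analysis.
From mathcomp Require Import ring lra.
Import Order.TTheory GRing.Theory Num.Theory.
Local Open Scope ring_scope.

(* For c >= 0, f c = g (c ^ 2), where g x = f (sqrt x) is convex with g 0 = 0,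
   hence superadditive.  The claim is superadditivity of g along
   (a + b) ^ 2 = a ^ 2 + b ^ 2 + 2 a b. *)

(** A convex [g] on the half-line with [g 0 <= 0] lies on [[0, s]] below the line through the origin
    and [(s, g s)]. With [s = x + y], the bounds at [x] and [y] add up to [g (x + y)], which is
    superadditivity; the theorem applies it twice. *)

Lemma convex_function_ge0_le_chord (R : realType) (g : R -> R) (x s : R) :
  convex_function (`[0, +oo[%classic : set R) g -> g 0 <= 0 ->
  0 <= x -> x <= s -> 0 < s -> g x <= x / s * g s.
Proof.
move=> cg g0 x0 xs s0.
have t0 : 0 <= x / s by rewrite divr_ge0// ltW.
have t1 : x / s <= 1 by rewrite ler_pdivrMr// mul1r.
have sD : s \in (`[0, +oo[%classic : set R).
  by rewrite inE/= in_itv/= andbT ltW.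
have oD : 0 \in (`[0, +oo[%classic : set R).
  by rewrite inE/= in_itv/= andbT.
(* Convexity between [s] and [0] with weight [x / s]; the term in [g 0] is then dropped by its
   sign. *)
have : g (x / s * s + (1 - x / s) * 0) <= x / s * g s + (1 - x / s) * g 0.
  exact: cg (Itv01 t0 t1) s 0 sD oD.
rewrite mulr0 addr0 divfK ?gt_eqF// => /le_trans; apply.
by rewrite gerDl mulr_ge0_le0// subr_ge0.
Qed.

Lemma convex_function_superadditive (R : realType) (g : R -> R) (x y : R) :
  convex_function (`[0, +oo[%classic : set R) g -> g 0 <= 0 ->
  0 <= x -> 0 <= y -> g x + g y <= g (x + y).
Proof.
move=> cg g0 x0 y0; have [s0|] := ltP 0 (x + y).
  have hx : g x <= x / (x + y) * g (x + y).
    by apply: convex_function_ge0_le_chord; rewrite ?lerDl.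
  have hy : g y <= y / (x + y) * g (x + y).
    by apply: convex_function_ge0_le_chord; rewrite ?lerDr.
  apply: le_trans (lerD hx hy) _.
  by rewrite -mulrDl -mulrDl divff ?mul1r// gt_eqF.
(* In the degenerate case [x + y <= 0], both points are [0] and the claim reduces to [g 0 <= 0]. *)
move=> s0; have -> : x = 0 by lra.
have -> : y = 0 by lra.
by rewrite addr0 gerDl.
Qed.

Theorem proposition2p1 (R : realType) (f : R -> R) (a b : R) :
  radical_convex 2 f -> 0 <= a -> 0 <= b ->
  f a + f b + f (Num.sqrt (2 * a * b)) <= f (a + b).
Proof.
move=> [_ _ _ f0 cf] a0 b0.
pose g (x : R) := f (x `^ 2^-1).
have g0 : g 0 <= 0 by rewrite /g powR12_sqrt// sqrtr0 f0.
have fE c : 0 <= c -> f c = g (c ^+ 2).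
  by move=> c0; rewrite /g powR12_sqrt ?sqr_ge0// sqrtr_sqr ger0_norm.
have ab0 : 0 <= 2 * a * b by rewrite !mulr_ge0.
have -> : f (Num.sqrt (2 * a * b)) = g (2 * a * b) by rewrite /g powR12_sqrt.
rewrite (fE _ a0) (fE _ b0) (fE _ (addr_ge0 a0 b0)).
have -> : (a + b) ^+ 2 = a ^+ 2 + b ^+ 2 + 2 * a * b by ring.
(* The outer use splits off [2 * a * b]; the inner one separates [a ^+ 2] from [b ^+ 2]. *)
apply: le_trans (convex_function_superadditive _ g _ _ cf g0 _ ab0).
  by rewrite lerD2r convex_function_superadditive ?sqr_ge0.
by rewrite addr_ge0 ?sqr_ge0.
Qed.
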